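(* Let $S$ be a subsemigroup of $\mathbf{I}\mathbb{N}_{\infty}$ which contains $\mathscr{C}_{\mathbb{N}}$. Let $(S_I,\tau)$ be a Hausdorff locally compact semitopological semigroup, where $S_I=S\sqcup I$ (with $S$ a subsemigroup of $S_I$) and $I$ is a compact ideal of $S_I$. Then either $(S_I,\tau)$ is a compact semitopological semigroup or the ideal $I$ is open in $(S_I,\tau)$.
   Context: $\mathbb{N}=\{1,2,3,\ldots\}$. Partial maps are written on the right of their arguments and composed from left to right: $(x)(\gamma\delta)=((x)\gamma)\delta$. $\mathbf{I}\mathbb{N}_{\infty}$ is the monoid, under composition of partial maps, of all partial isometries $\gamma\colon\mathbb{N}\rightharpoonup\mathbb{N}$ (i.e. $|(x)\gamma-(y)\gamma|=|x-y|$ for all $x,y\in\operatorname{dom}\gamma$) such that $\mathbb{N}\setminus\operatorname{dom}\gamma$ and $\mathbb{N}\setminus\operatorname{ran}\gamma$ are finite. $\mathscr{C}_{\mathbb{N}}$ is the submonoid of $\mathbf{I}\mathbb{N}_{\infty}$ generated by $\alpha\colon\mathbb{N}\to\mathbb{N}\setminus\{1\}$, $(n)\alpha=n+1$, and $\beta\colon\mathbb{N}\setminus\{1\}\to\mathbb{N}$, $(n)\beta=n-1$. $S_I=S\sqcup I$ means that the underlying set of $S_I$ is the disjoint union of $S$ and $I$, and the operation of $S_I$ restricted to $S$ is that of $S$. A semitopological semigroup is a topological space with a separately continuous semigroup operation. A space is locally compact if every point has an open neighbourhood with compact closure. *)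

(* Defs.v *)
From HB Require Import structures.
From mathcomp Require Import all_boot ssralg ssrint zify.
From mathcomp Require Import all_classical topology.

Set Implicit Arguments.
Unset Strict Implicit.
Unset Printing Implicit Defensive.

Local Open Scope classical_set_scope.
Local Open Scope group_scope.

Definition posnat := {n : nat | (0 < n)%N}.

(* A partial map of the positive integers is encoded as a function
   [posnat -> option posnat], equal to [None] outside its domain. *)
Definition pdom (f : posnat -> option posnat) : set posnat :=
  [set x | exists y, f x = Some y].

Definition pran (f : posnat -> option posnat) : set posnat :=
  [set y | exists x, f x = Some y].

Definition partial_isometry (f : posnat -> option posnat) : Prop :=
  forall x y x' y', f x = Some x' -> f y = Some y' ->
    `|val x' - val y'|%N = `|val x - val y|%N.

Record INinf := MkINinf {
  pfun :> posnat -> option posnat;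
  pfun_isometry : partial_isometry pfun;
  pfun_cofinite_dom : finite_set (~` pdom pfun);
  pfun_cofinite_ran : finite_set (~` pran pfun) }.

Lemma INinf_ext (f g : INinf) : f =1 g -> f = g.
Proof.
case: f g => [f f1 f2 f3] [g g1 g2 g3] /= /funext fg.
by subst g; congr MkINinf; exact: Prop_irrelevance.
Qed.

HB.instance Definition _ := gen_eqMixin INinf.
HB.instance Definition _ := gen_choiceMixin INinf.

Lemma partial_isometry_inj f x y z :
  partial_isometry f -> f x = Some z -> f y = Some z -> x = y.
Proof.
by move=> fi fx fy; apply/val_inj; have := fi _ _ _ _ fx fy => /=; lia.
Qed.

Lemma pid_isometry : partial_isometry Some.
Proof. by move=> x y _ _ [<-] [<-]. Qed.

Lemma pid_cofinite_dom : finite_set (~` pdom Some).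
Proof.
by rewrite (_ : ~` _ = set0)// -subset0 => x /=; apply; exists x.
Qed.

Lemma pid_cofinite_ran : finite_set (~` pran Some).
Proof.
by rewrite (_ : ~` _ = set0)// -subset0 => x /=; apply; exists x.
Qed.

Definition INinf_one : INinf :=
  MkINinf pid_isometry pid_cofinite_dom pid_cofinite_ran.

(* Maps act on the right, so the product of [f] and [g] applies [f] first;
   [pcomp] takes its arguments in the opposite order. *)
Section composition.
Variables f g : INinf.

Lemma pcomp_isometry : partial_isometry (pcomp g f).
Proof.
move=> x y x' y'; rewrite /pcomp.
case fx : (f x) => [a|//] /= ga; case fy : (f y) => [b|//] /= gb.
by rewrite (pfun_isometry ga gb) (pfun_isometry fx fy).
Qed.

Lemma pcomp_cofinite_dom : finite_set (~` pdom (pcomp g f)).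
Proof.
apply: (@sub_finite_set _ _
  (~` pdom f `|` f @^-1` (Some @` (~` pdom g)))).
  move=> x /= nh; case fx : (f x) => [y|]; last by left; case=> y; rewrite fx.
  right; exists y => // -[z gy]; apply: nh; exists z.
  by rewrite /pcomp fx.
rewrite finite_setU; split; first exact: pfun_cofinite_dom.
apply: finite_preimage; last exact/finite_image/pfun_cofinite_dom.
move=> x y; rewrite !inE => -[a _ fx] [b _ fy] fxy.
by apply: (partial_isometry_inj (@pfun_isometry f) (esym fx)); rewrite -fxy.
Qed.

Lemma pcomp_cofinite_ran : finite_set (~` pran (pcomp g f)).
Proof.
apply: (@sub_finite_set _ _
  (~` pran g `|` Some @^-1` (g @` (~` pran f)))).
  move=> z /= nh; have [[y gy]|] := pselect (pran g z); last by left.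
  right; exists y => // -[x fx]; apply: nh; exists x.
  by rewrite /pcomp fx.
rewrite finite_setU; split; first exact: pfun_cofinite_ran.
apply: finite_preimage; last exact/finite_image/pfun_cofinite_ran.
by move=> x y _ _ [].
Qed.

Definition INinf_mul : INinf :=
  MkINinf pcomp_isometry pcomp_cofinite_dom pcomp_cofinite_ran.

End composition.

Lemma INinf_mulA : associative INinf_mul.
Proof.
by move=> f g h; apply: INinf_ext => x /=; rewrite /pcomp; case: (pfun f x).
Qed.

Lemma INinf_mul1 : left_id INinf_one INinf_mul.
Proof. by move=> f; exact: INinf_ext. Qed.

Lemma INinf_mulr1 : right_id INinf_one INinf_mul.
Proof.
by move=> f; apply: INinf_ext => x /=; rewrite /pcomp; case: (pfun f x).
Qed.

HB.instance Definition _ :=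
  isMonoid.Build INinf INinf_mulA INinf_mul1 INinf_mulr1.

Definition alpha_fun (x : posnat) : option posnat := insub (val x).+1.

(* [insub] returns [None] at [x = 1], where the predecessor is 0. *)
Definition beta_fun (x : posnat) : option posnat := insub (val x).-1.

Lemma alpha_funP x y : alpha_fun x = Some y <-> val y = (val x).+1.
Proof.
rewrite /alpha_fun; split; first by case: insubP => // u _ <- [<-].
by move=> <-; rewrite valK.
Qed.

Lemma beta_funP x y : beta_fun x = Some y <-> val x = (val y).+1.
Proof.
rewrite /beta_fun; split.
  case: insubP => // u _ uE [<-]; rewrite uE prednK//; exact: valP x.
by move=> ->; rewrite /= valK.
Qed.

Lemma alpha_isometry : partial_isometry alpha_fun.
Proof. by move=> x y x' y' /alpha_funP -> /alpha_funP ->; lia. Qed.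

Lemma beta_isometry : partial_isometry beta_fun.
Proof. by move=> x y x' y' /beta_funP -> /beta_funP ->; lia. Qed.

Definition posnat1 : posnat := Sub 1%N isT.

Lemma alpha_dom : pdom alpha_fun = setT.
Proof.
apply/seteqP; split=> // x _; exists (Sub (val x).+1 isT).
exact/alpha_funP.
Qed.

Lemma alpha_ran : pran alpha_fun = ~` [set posnat1].
Proof.
apply/seteqP; split=> [y [x /alpha_funP yE] y1 | [[//|[|n]] n0]/= y1].
- by have := svalP x; move: yE; rewrite y1 => -[<-].
- by case: y1; apply/val_inj.
- by exists (Sub n.+1 isT); exact/alpha_funP.
Qed.

Lemma beta_dom : pdom beta_fun = ~` [set posnat1].
Proof.
rewrite -alpha_ran; apply/seteqP.
by split=> x [y]; [move/beta_funP|move/alpha_funP] => xy; exists y;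
  [exact/alpha_funP|exact/beta_funP].
Qed.

Lemma beta_ran : pran beta_fun = setT.
Proof.
rewrite -alpha_dom; apply/seteqP.
by split=> x [y]; [move/beta_funP|move/alpha_funP] => xy; exists y;
  [exact/alpha_funP|exact/beta_funP].
Qed.

Lemma alpha_cofinite_dom : finite_set (~` pdom alpha_fun).
Proof. by rewrite alpha_dom setCT. Qed.

Lemma alpha_cofinite_ran : finite_set (~` pran alpha_fun).
Proof. by rewrite alpha_ran setCK. Qed.

Lemma beta_cofinite_dom : finite_set (~` pdom beta_fun).
Proof. by rewrite beta_dom setCK. Qed.

Lemma beta_cofinite_ran : finite_set (~` pran beta_fun).
Proof. by rewrite beta_ran setCT. Qed.

Definition alpha : INinf :=
  MkINinf alpha_isometry alpha_cofinite_dom alpha_cofinite_ran.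

Definition beta : INinf :=
  MkINinf beta_isometry beta_cofinite_dom beta_cofinite_ran.

Definition subsemigroup (G : semigroupType) (S : set G) : Prop :=
  forall x y, S x -> S y -> S (x * y).

Definition submonoid (G : monoidType) (S : set G) : Prop :=
  S 1 /\ subsemigroup S.

Definition CN : set INinf := smallest (@submonoid INinf) [set alpha; beta].

Definition ideal (G : semigroupType) (I : set G) : Prop :=
  forall x y, I x -> I (x * y) /\ I (y * x).

HB.mixin Record isSemitopologicalSemigroup T
    of Semigroup T & Topological T := {
  mulg_continuousr : forall a : T, continuous (fun x : T => a * x);
  mulg_continuousl : forall a : T, continuous (fun x : T => x * a)
}.

#[short(type="semitopologicalSemigroupType")]
HB.structure Definition SemitopologicalSemigroup :=
  {T of Semigroup T & Topological T & isSemitopologicalSemigroup T}.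

(* Main.v *)
Require Import Defs.
From mathcomp Require Import all_boot zify.
From mathcomp Require Import all_classical topology.

Set Implicit Arguments.
Unset Strict Implicit.
Unset Printing Implicit Defensive.

Local Open Scope classical_set_scope.
Local Open Scope group_scope.

(* The complement [iota S] of [I] is open, countable and locally compact, so
   by Baire category it has an isolated point; since the equations
   [alpha^p y = c] have finitely many solutions, translations carry this to
   every point of [iota S].  Suppose [I] is not open and let [W] be an open
   neighbourhood of [I] with compact closure.  Then the trace [A] of [W] on [S]
   is infinite and, two such neighbourhoods having traces that differ by a
   finite set, every translation by an element of [S] maps [A] into [A] up to
   finitely many exceptions.  The relation [alpha beta = 1] forces such a set
   to be cofinite in [S]: for [N] large, whether [beta^N x alpha^q] lies in [A]
   does not depend on [q], and for large [q] the points [x alpha^q] of all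
   [x] are linked through the powers of [alpha].  Hence every neighbourhood of
   the compact set [I] is cofinite, and the space is compact. *)

(** * Compactness and isolated points in topological spaces *)

(** Near-covering compactness is applied to the filter generated by the families of supersets of
    members of [P], a filter base because [P] is stable under unions. *)
Lemma compact_induction (T : topologicalType) (P : set T -> Prop) (K : set T) :
  P set0 -> (forall A B, P A -> P B -> P (A `|` B)) ->
  compact K -> (forall x, K x -> exists2 V, nbhs x V & P V) ->
  exists2 U, P U & K `<=` U°.
Proof.
move=> P0 PU /compact_near_coveringP/(_ _
  (filter_from P (fun C => [set D | C `<=` D])) (fun D x => nbhs x D)) cK locK.
have [||U PU' /(_ U (fun _ => id)) KU] := cK; last by exists U.
  apply: filter_from_filter; first by exists set0.
  by move=> A B PA PB; exists (A `|` B);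
    [exact: PU|move=> D; rewrite /= subUset].
move=> x /locK[V xV PV]; exists (V°, [set D | V `<=` D]).
  by split; [exact: nbhs_interior|exists V].
by move=> [y D] /= [yV VD]; exact: filterS VD yV.
Qed.

Lemma locally_compact_nbhs (T : topologicalType) (x : T) :
  locally_compact [set: T] -> exists2 V, nbhs x V & compact V /\ closed V.
Proof.
move=> /(_ x I)[V xV cV]; exists V => //.
by apply: (@filterS _ (nbhs x) _ [set y | setT y -> V y]) xV => y; exact.
Qed.

Lemma compact_nbhs (T : topologicalType) (K : set T) :
  locally_compact [set: T] -> compact K ->
  exists U, [/\ open U, K `<=` U & compact (closure U)].
Proof.
move=> lcT cK; have [|||U PU KU] := @compact_induction T precompact K _ _ cK.
- by rewrite precompactE closure0; exact: compact0.
- by move=> A B; rewrite !precompactE closureU; exact: compactU.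
- by move=> x _; have [V xV cV] := locally_compact_nbhs x lcT; exists V => //;
    exists V.
exists U°; split=> //; first exact: open_interior.
by rewrite -precompactE; apply: precompact_subset PU; exact: interior_subset.
Qed.

Lemma compact_isolated_finite (T : topologicalType) (K : set T) :
  compact K -> (forall x, K x -> open [set x]) -> finite_set K.
Proof.
move=> cK oK; have [|||U fU KU] := @compact_induction T finite_set K _ _ cK.
- exact: finite_set0.
- by move=> A B fA fB; rewrite finite_setU.
- move=> x Kx; exists [set x] => //.
  by apply: open_nbhs_nbhs; split=> //; exact: oK.
by apply: sub_finite_set fU; apply: subset_trans KU _; exact: interior_subset.
Qed.

(** If a filter had no cluster point, some member would miss an open set around [K], hence lie in a
    finite, so compact, set. *)
Lemma cofinite_nbhs_compact (T : topologicalType) (K : set T) :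
  compact K -> (forall U, open U -> K `<=` U -> finite_set (~` U)) ->
  compact [set: T].
Proof.
move=> cK Kcof F PF _; apply: contrapT => nF.
have noclust x : ~ cluster F x by move=> Fx; apply: nF; exists x.
pose P (C : set T) := exists2 B, F B & B `&` C = set0.
have [|||U [B FB BU] KU] := @compact_induction T P K _ _ cK.
- by exists setT; [exact: filterT|rewrite setI0].
- move=> A C [B FB BA] [D FD DC]; exists (B `&` D); first exact: filterI.
  by rewrite setIUr -setIA [D `&` A]setIC setIA BA set0I set0U -setIA DC setI0.
- move=> x _; have /existsNP[B /existsNP[V]] := noclust x.
  by move=> /not_implyP[FB /not_implyP[xV /set0P/negP/negPn/eqP BV]];
    exists V => //; exists B.
have /finite_compact : finite_set (~` U°).
  by apply: Kcof => //; exact: open_interior.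
case/(_ F PF) => [|x [_ Fx]]; last exact: noclust Fx.
apply: filterS FB => x Bx /interior_subset Ux.
by have : (B `&` U) x by []; rewrite BU.
Qed.

(* The Baire category argument for the singletons of a countable set. *)
Lemma countable_open_isolated (T : topologicalType) (O : set T) :
  hausdorff_space T -> locally_compact [set: T] ->
  open O -> O !=set0 -> countable O -> exists2 x, O x & open [set x].
Proof.
move=> hT lcT oO [x0 Ox0] /countable_injP[f finj]; apply: contrapT => noiso.
have regT : regular_space T.
  move=> x; have [V xV [cV _]] := locally_compact_nbhs x lcT.
  exact: compact_regular hT cV xV.
pose good (W : set T) := [/\ open W, W !=set0 & W `<=` O].
(* Shrink a good [W] so that its closure avoids the point numbered [n]; a [W] that is not good gets
   a dummy value. *)
have step (nW : nat * set T) : exists W', good nW.2 ->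
    [/\ good W', closure W' `<=` nW.2 &
      forall x, O x -> f x = nW.1 -> ~ closure W' x].
  case: nW => n W /=.
  have [[oW [w Ww] WO]|] := pselect (good W); last by exists set0.
  pose N := [set x | O x /\ f x = n].
  have N1 x y : N x -> N y -> x = y.
    by move=> [Ox fx] [Oy fy]; apply: finj; rewrite ?inE// fx.
  have oN : open (W `\` N).
    have [[x Nx]|N0] := pselect (N !=set0).
      rewrite (_ : N = [set x]).
        apply: openI => //; apply: closed_openC.
        exact/accessible_closed_set1/hausdorff_accessible.
      by apply/seteqP; split=> [y Ny|y ->//]; exact: N1.
    by rewrite (_ : N = set0) ?setD0//; apply: contrapT => /eqP/set0P.
  have [v [Wv Nv]] : W `\` N !=set0.
    (* [W] inside [N] would make [W] an open singleton. *)
    apply: contrapT => /set0P/negP/negPn/eqP; rewrite setD_eq0 => WN.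
    apply: noiso.
    exists w; first exact: WO.
    rewrite (_ : [set w] = W)//; apply/seteqP; split=> [_ ->//|y /WN Ny].
    by apply: N1 => //; exact: WN.
  have : nbhs v (W `\` N) by apply: open_nbhs_nbhs.
  move=> /regT[V vV clV]; exists V°.
  have clV' : closure V° `<=` W `\` N.
    by apply: subset_trans clV; apply: closureS; exact: interior_subset.
  split; first split.
  - exact: open_interior.
  - by exists v.
  - by apply: subset_trans WO => y /subset_closure/clV'[].
  - by move=> y /clV'[].
  - by move=> x Ox fx /clV'[_]; apply.
have [g gP] := choice step.
have [V xV [cV clV]] := locally_compact_nbhs x0 lcT.
pose W0 := V° `&` O.
pose W := fix W n := if n is n'.+1 then g (n', W n') else W0.
have goodW n : good (W n).
  elim: n => [|n IH] /=; last by have [] := gP (n, W n) IH.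
  split; last by move=> ? [].
    by apply: openI => //; exact: open_interior.
  by exists x0; split.
have Wdec n : closure (W n.+1) `<=` W n by have [] := gP (n, W n) (goodW n).
have Wle m n : (m <= n)%N -> W n `<=` W m.
  elim: n => [|n IH]; first by rewrite leqn0 => /eqP->.
  rewrite leq_eqVlt => /predU1P[->//|]; rewrite ltnS => /IH.
  by apply: subset_trans => y /subset_closure/Wdec.
(* A cluster point of the [W n] lies in every closure, yet the stage indexed by its own number
   excluded it. *)
have PF : ProperFilter (filter_from [set: nat] W).
  apply: filter_from_proper; last by move=> n _; have [] := goodW n.
  apply: filter_from_filter; first by exists 0%N.
  move=> m n _ _; exists (maxn m n) => //.
  by rewrite subsetI; split; apply: Wle; rewrite ?leq_maxl ?leq_maxr.
have [|x [_ Fx]] := cV _ PF.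
  by exists 0%N => // y [/interior_subset].
have clx n : closure (W n) x.
  by move: Fx; rewrite clusterE; apply; exists n.
have Ox : O x by have [_ _] := goodW 0%N; apply; exact: Wdec.
have [_ _ /(_ x Ox erefl)] := gP (f x, W (f x)) (goodW _).
by apply; exact: clx (f x).+1.
Qed.

(** * Partial isometries: powers of [alpha], finite fibres, countability *)

Lemma finite_set_inj (T U : Type) (f : T -> U) (A : set T) (B : set U) :
  {in A &, injective f} -> f @` A `<=` B -> finite_set B -> finite_set A.
Proof.
move=> finj fAB fB; rewrite -(eq_finite_set (inj_card_eq finj)).
exact: sub_finite_set fAB fB.
Qed.

Lemma posnat_finite_bounded (A : set posnat) :
  finite_set A -> exists M, forall x, A x -> (val x < M)%N.
Proof.
move=> /finite_seqP[s ->]; exists (\max_(x <- s) val x).+1 => x /= xs.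
by rewrite ltnS; apply: (@leq_bigmax_seq _ s predT (fun x : posnat => val x)).
Qed.

Lemma INinf_mulE (f g : INinf) x : (f * g) x = obind g (f x).
Proof. by []. Qed.

Lemma alpha_expE p x y : (alpha ^+ p) x = Some y <-> val y = (val x + p)%N.
Proof.
elim: p x => [|p IH] x.
  by rewrite addn0; split=> [[->]//|/val_inj->].
rewrite expgS INinf_mulE; case ax: (alpha x) => [z|] /=.
  by rewrite IH; move/alpha_funP: ax => ->; rewrite addSnnS.
by move: ax; rewrite /= /alpha_fun insubT.
Qed.

Lemma beta_expE p x y : (beta ^+ p) x = Some y <-> val x = (val y + p)%N.
Proof.
elim: p x => [|p IH] x.
  by rewrite addn0; split=> [[->]//|/val_inj->].
rewrite expgS INinf_mulE; case bx: (beta x) => [z|] /=.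
  by rewrite IH; move/beta_funP: bx => ->; rewrite addnS; split=> [->|[]].
split=> // xE; have y0 : (0 < val y + p)%N by have := valP y; lia.
suff : beta x = Some (Sub _ y0) by rewrite bx.
by apply/beta_funP; move: xE => /=; lia.
Qed.

Lemma alphaK : alpha * beta = 1.
Proof.
apply: INinf_ext => x; rewrite INinf_mulE; case ax: (alpha x) => [z|] /=.
  by apply/beta_funP; apply/alpha_funP.
by move: ax; rewrite /= /alpha_fun insubT.
Qed.

Lemma alpha_expK p : alpha ^+ p * beta ^+ p = 1.
Proof.
elim: p => [|p IH]; first by rewrite !expg0 mulg1.
by rewrite expgSr expgS mulgA -(mulgA _ alpha) alphaK mulg1.
Qed.

Lemma CN_alpha_exp p : CN (alpha ^+ p).
Proof.
move=> M [[M1 MM] abM]; elim: p => [//|p IH]; rewrite expgS.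
by apply: MM => //; apply: abM; left.
Qed.

Lemma CN_beta_exp p : CN (beta ^+ p).
Proof.
move=> M [[M1 MM] abM]; elim: p => [//|p IH]; rewrite expgS.
by apply: MM => //; apply: abM; right.
Qed.

Lemma INinf_pdom_gt (y : INinf) :
  exists M, forall x, (M <= val x)%N -> exists z, y x = Some z.
Proof.
have [M MP] := posnat_finite_bounded (@pfun_cofinite_dom y); exists M => x Mx.
by apply: contrapT => /MP; rewrite ltnNge Mx.
Qed.

Lemma INinf_dom_neq0 (y : INinf) : exists x z, y x = Some z.
Proof.
have [M MP] := INinf_pdom_gt y.
by exists (Sub M.+1 isT); apply: MP; rewrite SubK leqnSn.
Qed.

(* Far out, an element of [INinf] is a translation: the isometry leaves
   [y x = c + (x - M)] or [y x = c - (x - M)], and the latter is not positive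
   once [x >= M + c]. *)
Lemma INinf_eventually_shift (y : INinf) :
  exists p q, alpha ^+ p * y = alpha ^+ q.
Proof.
have [M MP] := INinf_pdom_gt y.
have [|c yc] := MP (Sub M.+1 isT); first by rewrite SubK leqnSn.
(* The point [x + M.+1 + c] is at distance [x + c > c] from [M.+1], so its image can only be
   [c + (x + c)]. *)
exists (M.+1 + val c)%N, (val c + val c)%N; apply: INinf_ext => x.
rewrite INinf_mulE.
have [a aE] : exists a : posnat, val a = (val x + (M.+1 + val c))%N.
  by exists (Sub (val x + M + val c).+1 isT); rewrite SubK; lia.
have /alpha_expE -> /= := aE.
have [|b yb] := MP a; first by rewrite aE; lia.
rewrite yb; apply/esym/alpha_expE.
by move: (pfun_isometry yb yc) aE (valP b) (valP x) => /=; lia.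
Qed.

(** [alpha * y] determines [y] away from 1, and the isometry condition bounds the value at 1; then
    induction on [p]. *)
Lemma alpha_exp_fiber_finite p c : finite_set [set y | alpha ^+ p * y = c].
Proof.
have fib1 d : finite_set [set y | alpha * y = d].
  have [x [z dx]] := INinf_dom_neq0 d.
  apply: (@finite_set_inj _ _ (fun y : INinf => y posnat1) _
      (insub @` `I_(val z + val x).+1)).
  - move=> y y'; rewrite !inE /= => yd y'd y1; apply: INinf_ext => n.
    have [->//|n1] := eqVneq n posnat1.
    have [m mn] : pran alpha n by rewrite alpha_ran; exact/eqP.
    have E (w : INinf) : w n = (alpha * w) m by rewrite INinf_mulE mn.
    by rewrite !E yd y'd.
  - move=> _ [y /= yd <-]; case y1: (y posnat1) => [u|]; last first.
      (* The index 0 stands for an undefined value, as [insub] is [None] there. *)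
      by exists 0%N => //; rewrite insubN.
    exists (val u); last by rewrite valK.
    move: dx; rewrite -yd INinf_mulE; case ax: (alpha x) => [v|//] /= yv.
    have := pfun_isometry y1 yv; move/alpha_funP: ax => -> /=; lia.
  - exact/finite_image/finite_II.
elim: p c => [|p IH] c.
  by apply: sub_finite_set (finite_set1 c) => y /=; rewrite mul1g.
apply: (@sub_finite_set _ _
    (\bigcup_(z in [set z | alpha * z = c]) [set y | alpha ^+ p * y = z])).
  by move=> y /= yc; exists (alpha ^+ p * y) => //=; rewrite mulgA -expgS.
by apply: bigcup_finite.
Qed.

Lemma INinf_countable : countable [set: INinf].
Proof.
rewrite (_ : setT = \bigcup_(pq in [set: nat * nat])
    [set y | alpha ^+ pq.1 * y = alpha ^+ pq.2]).
  apply: bigcup_countable => // pq _.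
  exact/finite_set_countable/alpha_exp_fiber_finite.
apply/seteqP; split=> // y _.
by have [p [q pq]] := INinf_eventually_shift y; exists (p, q).
Qed.

(** Right translation by [beta ^+ p] thus has only one point over 1, as the isolation argument
    needs. *)
Lemma alpha_exp_unique p y : y * beta ^+ p = 1 -> y = alpha ^+ p.
Proof.
move=> yp; apply: INinf_ext => x.
have : (y * beta ^+ p) x = Some x by rewrite yp.
rewrite INinf_mulE; case: (y x) => [z|//] /= /beta_expE zx.
exact/esym/alpha_expE.
Qed.

Lemma mul_alpha_exp_inj z : injective (fun q => z * alpha ^+ q).
Proof.
move=> q q' /(congr1 (fun f : INinf => pfun f)) zqq'.
have [x [w zx]] := INinf_dom_neq0 z.
have aw p : (z * alpha ^+ p) x = (alpha ^+ p) w by rewrite INinf_mulE zx.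
have awE p : (alpha ^+ p) w = insub (val w + p)%N.
  have w0 : (0 < val w + p)%N by have := valP w; rewrite /=; lia.
  by rewrite insubT; apply/alpha_expE; rewrite SubK.
move: (aw q); rewrite zqq' aw !awE => /(congr1 (oapp val 0%N)).
have [w0 w1] : (0 < val w + q)%N /\ (0 < val w + q')%N.
  by have := valP w; rewrite /=; lia.
by rewrite !insubT /= => /addnI.
Qed.

(** * Almost invariant infinite sets are cofinite *)

Lemma CN_almost_invariant_cofinite (S A : set INinf) :
  subsemigroup S -> CN `<=` S -> A `<=` S -> infinite_set A ->
  (forall s, S s -> finite_set [set x | A x /\ ~ A (s * x)]) ->
  (forall s, S s -> finite_set [set x | A x /\ ~ A (x * s)]) ->
  finite_set (S `\` A).
Proof.
move=> SM CNS AS Ainf Al Ar.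
have Sa p : S (alpha ^+ p) by apply: CNS; exact: CN_alpha_exp.
have Sb p : S (beta ^+ p) by apply: CNS; exact: CN_beta_exp.
(* Left translation by [beta ^+ p] and right translation by [alpha] have left
   inverses in [S], so they move only finitely many points into [A] as well. *)
have bA p : finite_set [set x | ~ A x /\ A (beta ^+ p * x)].
  apply: sub_finite_set (finite_image (fun x => alpha ^+ p * x) (Al _ (Sa p))).
  by move=> x /= [nAx Abx]; exists (beta ^+ p * x);
    rewrite /= mulgA alpha_expK mul1g.
have Aa : finite_set [set x | ~ A x /\ A (x * alpha)].
  apply: sub_finite_set (finite_image (fun x => x * beta) (Ar _ (Sb 1%N))).
  by move=> x /= [nAx Axa]; exists (x * alpha); rewrite /= -mulgA alphaK mulg1.
(* Finitely many points change membership in [A] under right translation by [alpha]; [N] exceeds one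
   domain point of each. *)
have [N NP] : exists N, forall x,
    A x /\ ~ A (x * alpha) \/ ~ A x /\ A (x * alpha) ->
    exists2 n : posnat, (val n < N)%N & pdom x n.
  have [d dP] := choice INinf_dom_neq0.
  pose E := [set x | A x /\ ~ A (x * alpha)] `|`
    [set x | ~ A x /\ A (x * alpha)].
  have /posnat_finite_bounded[N NP] : finite_set (d @` E).
    apply: finite_image; rewrite finite_setU; split=> //.
    exact: (Ar _ (Sa 1%N)).
  by exists N => x Ex; exists (d x); [apply: NP; exists x|exact: dP].
(* No domain point of [beta ^+ N * w] is below [N], so it is never such an exception. *)
have stab x q : A (beta ^+ N * x * alpha ^+ q) <-> A (beta ^+ N * x).
  elim: q => [|q <-]; first by rewrite mulg1.
  rewrite expgSr mulgA; set z := _ * alpha ^+ q.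
  have nz : ~ (A z /\ ~ A (z * alpha) \/ ~ A z /\ A (z * alpha)).
    move=> /NP[n nN [m]]; rewrite /z -mulgA INinf_mulE.
    case bn: ((beta ^+ N) n) => [k|//]; move/beta_expE: bn nN => ->.
    by rewrite ltnNge leq_addl.
  by split=> Az; apply: contrapT => nAz; apply: nz; [right|left].
have [[x [Sx Abx]]|noA] := pselect (exists x, S x /\ A (beta ^+ N * x));
    last first.
  exfalso; apply: Ainf; apply: sub_finite_set (Al _ (Sb N)) => x Ax.
  split=> // Abx.
  by apply: noA; exists x; split=> //; exact: AS.
suff bNA y : S y -> A (beta ^+ N * y).
  by apply: sub_finite_set (bA N) => y [Sy nAy]; split=> //; exact: bNA.
move=> Sy; apply: contrapT => nAby.
(* Left translation by [alpha ^+ p] takes the points [beta ^+ N * x * alpha ^+ q] of [A] to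
   [alpha ^+ (c + q)], so almost all of these are in [A]; left translation by [beta ^+ N * y] takes
   them out of [A], so almost none are. *)
have [p [c pc]] := INinf_eventually_shift (beta ^+ N * x).
have : finite_set [set q | ~ A (alpha ^+ (c + q))].
  apply: (@finite_set_inj _ _ (fun q => beta ^+ N * x * alpha ^+ q) _ _ _ _
      (Al _ (Sa p))).
    by move=> q q' _ _; exact: mul_alpha_exp_inj.
  move=> _ [q /= nAq <-]; split; first exact/stab.
  by rewrite mulgA pc -expgnDr.
have : finite_set [set q | A (alpha ^+ (c + q))].
  apply: (@finite_set_inj _ _ (fun q => alpha ^+ (c + q)) _ _ _ _
      (Al _ (SM _ _ (Sb N) Sy))).
    move=> q q' _ _; rewrite !expgnDr; exact: mul_alpha_exp_inj.
  move=> _ [q /= Aq <-]; split => //.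
  by move/stab.
move=> fA fN; apply: infinite_nat; apply: sub_finite_set
  (_ : finite_set ([set q | A (alpha ^+ (c + q))] `|`
    [set q | ~ A (alpha ^+ (c + q))])).
  by move=> q _; have [Aq|nAq] := pselect (A (alpha ^+ (c + q))); [left|right].
by rewrite finite_setU.
Qed.

(** * Isolated points and neighbourhoods of the compact ideal *)

Section ideal_remainder.
Variables (S : set INinf) (T : semitopologicalSemigroupType) (I : set T).
Variable iota : INinf -> T.
Hypotheses (SM : subsemigroup S) (CNS : CN `<=` S).
Hypothesis iota_bij : set_bij S (~` I) iota.
Hypothesis iotaM : forall x y, S x -> S y -> iota (x * y) = iota x * iota y.
Hypotheses (hT : hausdorff_space T) (lcT : locally_compact [set: T]).
Hypotheses (idI : ideal I) (cI : compact I).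

Let iota_inj : {in S &, injective iota}.
Proof. by case: iota_bij. Qed.

Let iota_notI x : S x -> ~ I (iota x).
Proof. by case: iota_bij => /(_ x). Qed.

Let notI_iota t : ~ I t -> exists2 x, S x & iota x = t.
Proof. by case: iota_bij => _ _ /[apply]. Qed.

Let open_notI : open (~` I).
Proof. by apply: closed_openC; exact: compact_closed. Qed.

(** Removing from [O] the closed set [I] and the finitely many other points leaves an open
    singleton. *)
Lemma finite_trace_isolated (O : set T) :
  open O -> finite_set [set y | S y /\ O (iota y)] ->
  forall x, S x -> O (iota x) -> open [set iota x].
Proof.
move=> oO fO x Sx Ox.
have cO : closed (iota @` ([set y | S y /\ O (iota y)] `\ x)).
  apply: (accessible_finite_set_closed.1 (hausdorff_accessible hT)).
  exact/finite_image/finite_setD.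
rewrite (_ : [set iota x] = (O `&` ~` I) `&`
    ~` (iota @` ([set y | S y /\ O (iota y)] `\ x))).
  by apply: openI; [exact: openI|exact: closed_openC].
apply/seteqP; split=> [_ ->|t [[Ot It] nt]].
  split; first by split=> //; exact: iota_notI.
  move=> [y [[Sy _] yx]] /iota_inj; rewrite !inE => /(_ Sy Sx).
  exact: yx.
have [y Sy yt] := notI_iota It.
have [<-//|/eqP yx] := eqVneq y x.
by case: nt; exists y => //; split=> //; split=> //; rewrite yt.
Qed.

Lemma isolated_translate (f : T -> T) (h : INinf -> INinf) x :
  continuous f -> (forall y, S y -> iota (h y) = f (iota y)) ->
  (forall y, S y -> S (h y)) ->
  finite_set [set y | S y /\ h y = h x] -> S x ->
  open [set iota (h x)] -> open [set iota x].
Proof.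
move=> fc hf Sh hfin Sx ohx.
apply: (@finite_trace_isolated (f @^-1` [set iota (h x)])) => //.
- by apply: open_comp => // y _; exact: fc.
- apply: sub_finite_set hfin => y /= [Sy]; rewrite -hf// => hyx; split=> //.
  by apply: iota_inj; rewrite ?inE//; exact: Sh.
- by rewrite /= hf.
Qed.

(** Isolation passes from some [s = s * 1] to 1, from [1 = alpha ^+ p * beta ^+ p] to [alpha ^+ p],
    and from [alpha ^+ q = alpha ^+ p * x] to [x]. *)
Lemma isolated_iota x : S x -> open [set iota x].
Proof.
have Sa p : S (alpha ^+ p) by apply: CNS; exact: CN_alpha_exp.
have Sb p : S (beta ^+ p) by apply: CNS; exact: CN_beta_exp.
have S1 : S 1 := Sa 0%N.
have cntI : countable (~` I).
  apply: (@sub_countable _ _ _ [set: INinf]); last exact: INinf_countable.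
  apply: (@card_le_trans _ _ _ (iota @` [set: INinf]));
    last exact: card_image_le.
  by apply: subset_card_le => t /notI_iota[y _ <-]; exists y.
have [|t /notI_iota[s Ss <-] os] :=
    countable_open_isolated hT lcT open_notI _ cntI.
  by exists (iota 1); exact: iota_notI.
have left_isolated s' y : S s' -> S y -> finite_set [set z | s' * z = s' * y] ->
    open [set iota (s' * y)] -> open [set iota y].
  move=> Ss' Sy fin.
  apply: (isolated_translate (f := fun t => iota s' * t)) => //.
  - exact: mulg_continuousr.
  - by move=> z Sz; exact: iotaM.
  - by move=> z Sz; exact: SM.
  - by apply: sub_finite_set fin => z [].
have o1 : open [set iota 1].
  apply: (left_isolated s); rewrite ?mulg1//.
  have [p [q pq]] := INinf_eventually_shift s.
  apply: sub_finite_set (alpha_exp_fiber_finite q (alpha ^+ q)) => z /= sz.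
  by rewrite -pq -mulgA sz.
have oa p : open [set iota (alpha ^+ p)].
  apply: (isolated_translate (f := fun t => t * iota (beta ^+ p))
    (h := fun y => y * beta ^+ p)) => //.
  - exact: mulg_continuousl.
  - by move=> z Sz; exact: iotaM.
  - by move=> z Sz; exact: SM.
  - apply: sub_finite_set (finite_set1 (alpha ^+ p)) => z /= [_].
    by rewrite alpha_expK; exact: alpha_exp_unique.
  - by rewrite alpha_expK.
move=> Sx; have [p [q pq]] := INinf_eventually_shift x.
apply: (left_isolated (alpha ^+ p)) => //; first exact: alpha_exp_fiber_finite.
by rewrite pq.
Qed.

Lemma nbhs_ideal_cofinite (V : set T) :
  ~ open I -> open V -> I `<=` V -> finite_set (~` V).
Proof.
move=> nI oV IV; have [U [oU IU cU]] := compact_nbhs lcT cI.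
pose W := U `&` V; have oW : open W by exact: openI.
have IW : I `<=` W by move=> t It; split; [exact: IU|exact: IV].
(* The difference lies in the compact set [closure U] minus [O], all of whose points are
   isolated. *)
have almost O : open O -> I `<=` O ->
    finite_set [set x | S x /\ (W (iota x) /\ ~ O (iota x))].
  move=> oO IO; apply: (@finite_set_inj _ _ iota _ (closure U `\` O)).
  - by move=> x y; rewrite !inE => -[Sx _] [Sy _]; apply: iota_inj; rewrite inE.
  - move=> _ [x [Sx [[Ux _] Ox]] <-]; split=> //; exact: subset_closure.
  - apply: compact_isolated_finite.
      by apply: compact_closedI => //; exact: open_closedC.
    move=> t [_ Ot]; have [|x Sx <-] := @notI_iota t; first by move/IO.
    exact: isolated_iota.
pose A := [set x | S x /\ W (iota x)].
(* Otherwise [I] would be [W] minus a finite closed set, hence open. *)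
have Ainf : infinite_set A.
  move=> fA; apply: nI; rewrite (_ : I = W `&` ~` (iota @` A)).
    apply: openI => //; apply: closed_openC.
    apply: (accessible_finite_set_closed.1 (hausdorff_accessible hT)).
    exact: finite_image.
  apply/seteqP; split=> [t It|t [Wt nAt]].
    split; first exact: IW.
    by move=> [x [Sx _] xt]; apply: (iota_notI Sx); rewrite xt.
  apply: contrapT => /notI_iota[x Sx xt]; apply: nAt; exists x => //.
  by split=> //; rewrite xt.
have fSA : finite_set (S `\` A).
  apply: CN_almost_invariant_cofinite => //; first by move=> x [].
  - move=> s Ss.
    (* As [I] is an ideal, the preimage of [W] under a translation is again an open set containing
       [I]. *)
    apply: sub_finite_set (almost ((fun t => iota s * t) @^-1` W) _ _).
    + move=> x [[Sx Wx] nAx]; split=> //; split=> // Wsx; apply: nAx.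
      by split; [exact: SM|rewrite iotaM].
    + by apply: open_comp => // t _; exact: mulg_continuousr.
    + by move=> t It; apply: IW; have [] := idI (iota s) It.
  - move=> s Ss.
    apply: sub_finite_set (almost ((fun t => t * iota s) @^-1` W) _ _).
    + move=> x [[Sx Wx] nAx]; split=> //; split=> // Wsx; apply: nAx.
      by split; [exact: SM|rewrite iotaM].
    + by apply: open_comp => // t _; exact: mulg_continuousl.
    + by move=> t It; apply: IW; have [] := idI (iota s) It.
apply: sub_finite_set (finite_image iota fSA) => t Vt.
have [|x Sx xt] := @notI_iota t; first by move/IV.
by exists x => //; split=> // -[_ []]; rewrite xt.
Qed.

End ideal_remainder.

(* [iota] identifies [S] with the complement of [I] in the carrier [T] of
   S_I; its values outside [S] are irrelevant. *)
Theorem theorem3p17 (S : set INinf) (T : semitopologicalSemigroupType)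
    (I : set T) (iota : INinf -> T) :
  subsemigroup S -> CN `<=` S ->
  set_bij S (~` I) iota ->
  (forall x y, S x -> S y -> iota (x * y) = iota x * iota y) ->
  hausdorff_space T -> locally_compact [set: T] ->
  ideal I -> compact I ->
  compact [set: T] \/ open I.
Proof.
move=> SM CNS iota_bij iotaM hT lcT idI cI.
have [oI|nI] := pselect (open I); [by right|left].
apply: (cofinite_nbhs_compact cI) => U oU IU.
exact: (@nbhs_ideal_cofinite S T I iota).
Qed.
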